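(* Let $d$ and $k$ be integers with $1\le k\le d-1$ and let $\varepsilon\in(0,1)$. There exist a positive integer $r=r(d,\varepsilon,k)$ and a constant $c=c(d,\varepsilon,k)>0$ such that the following holds. Let $\Lambda\subseteq\mathbb{R}^d$ be a $d$-dimensional lattice and let $K\subseteq\mathbb{R}^d$ be a $d$-dimensional compact convex body symmetric about the origin, and write $\lambda_i=\lambda_i(\Lambda,K)$ for $i=1,\dots,d$. If $\lambda_d\le 1$, then there is a set $S\subseteq\Lambda\cap K$ with $|S|\ge c\,((1-\lambda_d)\beta)^{d-k-\varepsilon}$, where \[\beta=\min_{1\le j\le d-1}(\lambda_j\cdots\lambda_d)^{-1/(d-j)},\] such that every $k$-dimensional linear subspace of $\mathbb{R}^d$ contains at most $r-1$ points of $S$.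
   Context: A $d$-dimensional lattice is the set of all integer linear combinations of $d$ linearly independent vectors of $\mathbb{R}^d$. For a lattice $\Lambda$ and a compact convex body $K$ symmetric about the origin ($K=-K$), the $i$th successive minimum is $\lambda_i(\Lambda,K)=\inf\{\lambda\in\mathbb{R}:\dim(\Lambda\cap(\lambda K))\ge i\}$, where $\dim$ denotes the dimension of the affine hull. *)

(* Defs.v *)
From HB Require Import structures.
From mathcomp Require Import all_boot all_order all_algebra.
From mathcomp Require Import all_classical all_reals all_analysis.
Set Implicit Arguments. Unset Strict Implicit. Unset Printing Implicit Defensive.
Import Order.TTheory GRing.Theory Num.Theory.
Import numFieldNormedType.Exports.
Local Open Scope classical_set_scope.
Local Open Scope ring_scope.

Definition lattice (R : realType) (d : nat) (B : 'M[R]_d) : set 'rV[R]_d :=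
  [set v | exists z : 'rV[int]_d, v = map_mx (fun a : int => a%:~R) z *m B].

Definition is_lattice_basis (R : realType) (d : nat) (B : 'M[R]_d) : Prop :=
  B \in unitmx.

Definition symmetric_set (R : realType) (d : nat) (K : set 'rV[R]_d) : Prop :=
  forall x, K x -> K (- x).

(* "dim A >= i": the affine hull of A has dimension at least i, i.e. A
   contains i+1 affinely independent points a0, a0 + M_0, ..., a0 + M_(i-1). *)
Definition affdim_ge (R : realType) (d : nat) (A : set 'rV[R]_d) (i : nat) : Prop :=
  exists (a0 : 'rV[R]_d) (M : 'M[R]_(i, d)),
    A a0 /\ (forall j : 'I_i, A (a0 + row j M)) /\ row_free M.

Definition dilate (R : realType) (d : nat) (l : R) (K : set 'rV[R]_d) : set 'rV[R]_d :=
  [set l *: x | x in K].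

Definition succ_min (R : realType) (d : nat) (B : 'M[R]_d) (K : set 'rV[R]_d)
  (i : nat) : R :=
  inf [set l : R | 0 < l /\ affdim_ge (lattice B `&` dilate l K) i].

Definition beta_min (R : realType) (d : nat) (B : 'M[R]_d) (K : set 'rV[R]_d) : R :=
  let f := fun j : nat =>
    powR (\prod_(j <= i < d.+1) succ_min B K i) (- (1 / (d - j)%:R)) in
  \big[Num.min/f 1%N]_(1 <= j < d) f j.

(* Main.v *)
Require Import Defs.
From HB Require Import structures.
From mathcomp Require Import all_boot all_order all_algebra mxabelem.
From mathcomp Require Import all_classical all_reals all_analysis.
From mathcomp Require Import ring lra zify.
Import Order.TTheory GRing.Theory Num.Theory.
Import numFieldNormedType.Exports.
Local Open Scope classical_set_scope.
Local Open Scope ring_scope.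

(** Let [p] be a prime.  A random family of about [p^(d-k-eps)] vectors of
    [F_p^d] has fewer than [r] members in every [k]-dimensional subspace once
    [r > d^2/eps]: there are at most [p^(d^2)] subspaces and [p^((d-k-eps)r)]
    ways to choose [r] members, and a given subspace contains given [r] members
    with probability [p^(-(d-k)r)].  Reduction modulo [p] does not
    increase the rank of integer vectors, so it is enough to find, for every
    vector [v] of [F_p^d], a point of the lattice inside [K] whose coordinates
    are congruent to a nonzero multiple of [v].

    Coordinates are taken in independent lattice vectors [b_i] in
    [mu_i K], with [mu_i <= 2 lambda_i].  If [lambda_d < 1/(4d)], Dirichlet's
    pigeonhole argument applied to the multiples of [v] produces coordinates
    bounded by [1/(2 d lambda_i)], as soon as [p <= beta/(128 d^2)].  Otherwise
    scale [v] so that its last coordinate is [0] or [1]: the factor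
    [1 - lambda_d] is what remains for the other coordinates, and
    [beta <= 4d/lambda_(d-1)].  A prime [p] close enough to
    [(1 - lambda_d) beta/(128 d^2)] is obtained from
    [2^n <= 'C(2n, n) <= (2n)^p], where [p] is the largest prime divisor of
    ['C(2n, n)]. *)

(** * Prime divisors of central binomial coefficients *)

Lemma expn2_le_bin_double n : (2 ^ n <= 'C(n.*2, n))%N.
Proof.
elim: n => [|n IHn] //.
have bin_sym : 'C((n.*2).+1, n.+1) = 'C((n.*2).+1, n).
  by rewrite -[LHS]bin_sub ?subSS -?addnn ?addnK //; rewrite ltnS leq_addr.
rewrite doubleS binS bin_sym expnS mul2n addnn leq_double (leq_trans IHn) //.
by case: n {IHn bin_sym} => // n; rewrite binS leq_addr.
Qed.

(** By Legendre's formula the exponent of [p] is the sum over [i] of floor(2n/p^i) - 2 floor(n/p^i).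
    Each term is 0 or 1 and vanishes once p^i > 2n. *)
Lemma expn_logn_bin_double p n : prime p -> (0 < n)%N ->
  (p ^ logn p 'C(n.*2, n) <= n.*2)%N.
Proof.
move=> p_pr n_gt0; have p_gt1 := prime_gt1 p_pr.
have n2_gt0 : (0 < n.*2)%N by rewrite double_gt0.
apply: leq_trans (trunc_logP p_gt1 n2_gt0); rewrite leq_exp2l //.
set t := trunc_log p n.*2.
have fact_eq : ('C(n.*2, n) * (n`! * n`!) = n.*2`!)%N.
  by rewrite -[RHS](@bin_fact n.*2 n) -addnn ?leq_addr // addnK.
have logn_eq : (logn p 'C(n.*2, n) + (logn p n`! + logn p n`!) = logn p n.*2`!)%N.
  rewrite -fact_eq !lognM ?muln_gt0 ?fact_gt0 ?bin_gt0 //.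
  by rewrite -addnn leq_addr.
have t_lt : (t < n.*2.+1)%N.
  by rewrite ltnS (leq_trans _ (trunc_logP p_gt1 n2_gt0)) // ltnW // ltn_expl.
have n_le : (n < n.*2.+1)%N by rewrite ltnS -addnn leq_addr.
rewrite !logn_fact // in logn_eq.
have sum_n : (\sum_(1 <= i < n.+1) n %/ p ^ i = \sum_(1 <= i < n.*2.+1) n %/ p ^ i)%N.
  rewrite [RHS](@big_cat_nat _ _ _ n.+1) //=.
  rewrite [X in _ = (_ + X)%N]big_nat [X in _ = (_ + X)%N]big1 ?addn0 // => i.
  case/andP=> ni _.
  by rewrite divn_small // (leq_ltn_trans (ltnW ni)) // ltn_expl.
rewrite sum_n -big_split /= in logn_eq.
rewrite -(leq_add2r (\sum_(1 <= i < n.*2.+1) (n %/ p ^ i + n %/ p ^ i))) logn_eq.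
(* Writing [t] as a sum of indicators reduces the bound to a comparison term by term. *)
have -> : t = (\sum_(1 <= i < n.*2.+1) (i <= t))%N.
  rewrite (@big_cat_nat _ _ _ t.+1) //=.
  rewrite (@eq_big_nat _ _ _ 1 t.+1 _ (fun=> 1%N)); last first.
    by move=> i /andP[_]; rewrite ltnS => ->.
  rewrite [X in (_ + X)%N]big_nat [X in (_ + X)%N]big1 => [|i /andP[ti _]]; last first.
    by rewrite leqNgt ti.
  by rewrite sum_nat_const_nat muln1 subn1 addn0.
rewrite -big_split /= leq_sum // => i _.
have pi_gt0 : (0 < p ^ i)%N by rewrite expn_gt0 ltnW.
case: (leqP i t) => [_|lt_ti]; last first.
  by rewrite divn_small // (leq_trans (trunc_log_ltn _ p_gt1)) // leq_exp2l.
have := divn_eq n.*2 (p ^ i); have := divn_eq n (p ^ i).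
by have := ltn_pmod n pi_gt0; have := ltn_pmod n.*2 pi_gt0; nia.
Qed.

Lemma leq_prod_exp (T : eqType) (s : seq T) (F : T -> nat) m :
  {in s, forall x, F x <= m}%N -> (\prod_(x <- s) F x <= m ^ size s)%N.
Proof.
elim: s => [|x s IHs] Fm; first by rewrite big_nil.
rewrite big_cons expnS leq_mul ?Fm ?mem_head // IHs // => y ys.
by rewrite Fm // inE ys orbT.
Qed.

(** All prime divisors of [b] lie between 1 and the largest one, [p], so there are at most [p] of
    them, and each contributes a prime power of at most 2n. *)
Lemma exists_prime_expn_double n : (0 < n)%N ->
  exists p, [/\ prime p, (p <= n.*2)%N & (2 ^ n <= n.*2 ^ p)%N].
Proof.
move=> n_gt0; set b := 'C(n.*2, n).
have b_gt1 : (1 < b)%N.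
  by rewrite (leq_trans _ (expn2_le_bin_double n)) // -{1}(expn1 2) leq_exp2l.
have b_gt0 := ltnW b_gt1; have p_pr := max_pdiv_prime b_gt1.
exists (max_pdiv b); split=> //.
  rewrite (leq_trans _ (expn_logn_bin_double _ _ p_pr n_gt0)) //.
  by rewrite -{1}(expn1 (max_pdiv b)) leq_exp2l ?prime_gt1 // logn_gt0 pi_max_pdiv.
rewrite (leq_trans (expn2_le_bin_double n)) // -/b.
rewrite [X in (X <= _)%N](prod_prime_decomp b_gt0) prime_decompE big_map /=.
have size_le : (size (primes b) <= max_pdiv b)%N.
  rewrite -[X in (_ <= X)%N](size_iota 1) uniq_leq_size ?primes_uniq // => q qb.
  rewrite mem_iota add1n ltnS max_pdiv_max // andbT.
  by move: qb; rewrite mem_primes => /andP[/prime_gt0].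
apply: leq_trans (_ : n.*2 ^ size (primes b) <= _)%N; last first.
  by rewrite leq_pexp2l // double_gt0.
apply: leq_prod_exp => q; rewrite mem_primes => /andP[q_pr _]; exact: expn_logn_bin_double.
Qed.

(** * Families over a finite field with few members in each subspace *)

Lemma card_row_submx (F : finFieldType) m d (W : 'M[F]_(m, d)) :
  #|[pred v : 'rV[F]_d | (v <= W)%MS]| = (#|F| ^ \rank W)%N.
Proof. by rewrite -card_rowg; apply: eq_card => v; rewrite !inE. Qed.

(** Union bound by counting. A bad event is a matrix [W] spanning a small subspace with [r] distinct
    indices [J]; at most q^(kr) q^(d(M-r)) families realise it, and there are at most q^(d^2) M^r
    events. The hypothesis keeps the product below the number q^(dM) of all families. *)
Lemma exists_ffun_few_in_subspace (F : finFieldType) (d k r M : nat) :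
  (k <= d)%N ->
  (#|F| ^ (d * d) * M ^ r < #|F| ^ ((d - k) * r))%N ->
  exists T : {ffun 'I_M -> 'rV[F]_d}, forall W : 'M[F]_d, (\rank W <= k)%N ->
    (#|[set i | (T i <= W)%MS]%SET| < r)%N.
Proof.
move=> le_kd M_small; set q := #|F| in M_small.
have q_gt0 : (0 < q)%N by apply/card_gt0P; exists 0.
pose in_sub (WJ : 'M[F]_d * {ffun 'I_r -> 'I_M}) (T : {ffun 'I_M -> 'rV[F]_d}) :=
  [forall i, (T (WJ.2 i) <= WJ.1)%MS].
pose bad := [pred WJ : 'M[F]_d * {ffun 'I_r -> 'I_M} |
  (\rank WJ.1 <= k)%N & injectiveb WJ.2].
suff [T T_good] : exists T, forall WJ, bad WJ -> ~~ in_sub WJ T.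
  exists T => W rkW; rewrite ltnNge; apply/negP => le_r.
  pose J := [ffun i : 'I_r => enum_val (widen_ord le_r i)].
  have J_inj : injectiveb J.
    apply/injectiveP => i j; rewrite !ffunE => /enum_val_inj /(congr1 val) /= ij.
    exact: val_inj.
  have /negP := T_good (W, J) (introT andP (conj rkW J_inj)); apply.
  apply/forallP => i; rewrite ffunE.
  by have := enum_valP (widen_ord le_r i); rewrite inE.
case: (pickP [pred T | [forall WJ, bad WJ ==> ~~ in_sub WJ T]]) => [T /forallP T_good|].
  by exists T => WJ; apply/implyP.
move=> all_bad.
have card_sub WJ : bad WJ ->
    (r <= M /\ #|[pred T | in_sub WJ T]| <= q ^ (k * r) * q ^ (d * (M - r)))%N.
  case: WJ => W J /andP[/= rkW /injectiveP J_inj].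
  pose I := [set J i | i : 'I_r].
  have cardI : #|I| = r by rewrite card_imset // card_ord.
  have cardIC : (#|[predC I]| = M - r)%N.
    by have := cardC (mem I); rewrite cardI card_ord => /(f_equal (subn^~ r)); rewrite addKn.
  split; first by rewrite -cardI (leq_trans (max_card _)) ?card_ord.
  pose A i : pred 'rV[F]_d := [pred v | (i \in I) ==> (v <= W)%MS].
  rewrite (eq_card (B := family A)) ?card_family; last first.
    move=> T; rewrite inE; apply/forallP/familyP => /= TW i.
      by rewrite inE; apply/implyP => /imsetP[j _ ->].
    by have := TW (J i); rewrite inE imset_f.
  rewrite foldrE big_map big_enum /= (bigID (mem I)) /= leq_mul //.
    rewrite (eq_bigr (fun=> q ^ \rank W)%N) => [|i iI]; last first.
      by rewrite -card_row_submx; apply: eq_card => v; rewrite !inE iI.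
    by rewrite prod_nat_const cardI -expnM leq_pexp2l // leq_mul2r rkW orbT.
  rewrite (eq_bigr (fun=> q ^ d)%N) => [|i iI]; last first.
    rewrite -[X in (q ^ X)%N]mul1n -card_mx; apply: eq_card => v.
    by rewrite !inE (negPf iI).
  by rewrite prod_nat_const -expnM cardIC.
have : (#|{: {ffun 'I_M -> 'rV[F]_d}}| <=
    \sum_(WJ | bad WJ) #|[pred T | in_sub WJ T]|)%N.
  under eq_bigr do rewrite -sum1_card.
  rewrite (exchange_big_dep xpredT) //= -sum1_card leq_sum // => T _.
  have /negbT := all_bad T; rewrite /= negb_forall => /existsP[WJ].
  rewrite negb_imply negbK => WJ_bad.
  by rewrite (bigD1 WJ) //= leq_addr.
(* A bad event forces [r <= M], so the truncated subtraction [M - r] is a true one below. With no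
   bad event the sum is empty, although some family exists. *)
case: (pickP bad) => [WJ0 /card_sub[le_rM _]|no_bad]; last first.
  rewrite big_pred0 // leqn0 card_ffun card_mx card_ord expn_eq0.
  by rewrite expn_eq0 !gtn_eqF.
rewrite leqNgt => /negP; case.
apply: (@leq_ltn_trans (\sum_(WJ : 'M[F]_d * {ffun 'I_r -> 'I_M})
    q ^ (k * r) * q ^ (d * (M - r)))%N).
  rewrite big_mkcond /= leq_sum // => WJ _; case: ifP => // WJ_bad.
  by case: (card_sub WJ WJ_bad).
rewrite sum_nat_const card_prod !card_ffun !card_mx !card_ord -/q mul1n -expnM.
have -> : (d * M = (d - k) * r + (k * r + d * (M - r)))%N by nia.
by rewrite expnD -expnD ltn_pmul2r ?expn_gt0 ?q_gt0.
Qed.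

(** * Rank under reduction modulo a prime *)

(** A nonzero minor of maximal size over [F] is the image of an integer minor. That integer is
    nonzero, so it stays nonzero in characteristic 0. *)
Lemma mxrank_intr_le (F : fieldType) (R : numFieldType) (n d : nat)
    (Z : 'M[int]_(n, d)) :
  (\rank (map_mx intr Z : 'M[F]_(n, d)) <= \rank (map_mx intr Z : 'M[R]_(n, d)))%N.
Proof.
set A : 'M[F]_(n, d) := map_mx _ _; set A' := map_mx _ _.
set f := maxrankfun A; have A1_free := maxrowsub_free A; rewrite -/f in A1_free.
have A1T_full : row_full (rowsub f A)^T by rewrite /row_full mxrank_tr.
set g := fullrankfun A1T_full; have := fullrowsub_unit A1T_full; rewrite -/g.
pose C := rowsub g (rowsub f Z)^T.
have -> : rowsub g (rowsub f A)^T = map_mx intr C by apply/matrixP => i j; rewrite !mxE.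
rewrite unitmxE det_map_mx unitfE => detC.
have C'_unit : rowsub g (rowsub f A')^T \in unitmx.
  have -> : rowsub g (rowsub f A')^T = map_mx intr C.
    by apply/matrixP => i j; rewrite !mxE.
  rewrite unitmxE det_map_mx unitfE intr_eq0.
  by apply: contraNneq detC => ->; rewrite rmorph0.
have rowsub_le m m' l (h : 'I_m -> 'I_m') (M : 'M[R]_(m', l)) : (rowsub h M <= M)%MS.
  by apply/row_subP => i; rewrite row_rowsub row_sub.
rewrite -(mxrank_unit C'_unit) (leq_trans (mxrankS (rowsub_le _ _ _ _ _))) //.
by rewrite mxrank_tr mxrankS.
Qed.

(** * Dirichlet's pigeonhole argument modulo a prime *)

Lemma intr_val_Fp (p : nat) (a : 'F_p) : (nat_of_ord a)%:Z%:~R = a.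
Proof. by rewrite -pmulrn natr_Zp. Qed.

Lemma eq_divn_dist (a b n : nat) :
  (0 < n)%N -> (a %/ n = b %/ n)%N -> (`|a%:Z - b%:Z| <= n)%N.
Proof.
move=> n_gt0 ab; have := ltn_pmod a n_gt0; have := ltn_pmod b n_gt0.
by have := divn_eq a n; have := divn_eq b n; rewrite ab; lia.
Qed.

(** The [p] multiples of [v] are sorted into boxes with side [N i] in coordinate [i]. There are
    fewer than [p] boxes, so two multiples share one, and their difference is short. *)
Lemma dirichlet_Fp (p d : nat) (N : 'I_d -> nat) (v : 'rV['F_p]_d) :
  prime p -> (forall i, 0 < N i)%N ->
  (\prod_i (p.-1 %/ N i).+1 < p)%N ->
  exists2 m : 'F_p, m != 0 & exists2 x : 'rV[int]_d,
    map_mx intr x = m *: v & forall i, (`|x 0%R i| <= N i)%N.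
Proof.
move=> p_pr N_gt0 N_big.
pose cell (m : 'F_p) : {dffun forall i : 'I_d, 'I_(p.-1 %/ N i).+1} :=
  [ffun i => inord ((m * v 0 i)%R %/ N i)].
have val_lt (a : 'F_p) : (a < p)%N by rewrite -[X in (_ < X)%N](Fp_cast p_pr).
have Nval_lt (a : 'F_p) i : (a %/ N i < (p.-1 %/ N i).+1)%N.
  by rewrite ltnS leq_div2r // -ltnS prednK ?prime_gt0.
have /injectivePn[m [m' neq_m /ffunP cell_eq]] : ~~ injectiveb cell.
  apply: contraL N_big => /injectiveP /leq_card.
  rewrite card_Fp // card_dep_ffun foldrE big_map big_enum /= -leqNgt.
  by under eq_bigr do rewrite card_ord.
exists (m - m'); first by rewrite subr_eq0.
exists (\row_i ((m * v 0 i)%R%:Z - (m' * v 0 i)%R%:Z)).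
  by apply/rowP => i; rewrite !mxE mulrzBr !intr_val_Fp mulrBl.
move=> i; rewrite mxE; have := cell_eq i; rewrite !ffunE => /(congr1 (@nat_of_ord _)).
by rewrite !inordK //; apply: eq_divn_dist.
Qed.

(** * From vectors modulo a prime to lattice points *)

Lemma size_leq_undup (T : eqType) (s : seq T) (r : nat) :
  (forall x, count_mem x s <= r)%N -> (size s <= size (undup s) * r)%N.
Proof.
move=> count_le; rewrite -sum1_size -big_undup_iterop_count /=.
rewrite -sum1_size big_distrl leq_sum // => x _.
by rewrite Monoid.iteropE iter_addn_0 leq_mul.
Qed.

(* The [X v] represent the lines spanned by the [v] in the lattice, hence real
   subspaces contain no more of them than subspaces over ['F_p] do. *)
Lemma lift_few_in_subspace (R : numFieldType) (p d k r M : nat)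
    (T : {ffun 'I_M -> 'rV['F_p]_d}) (X : 'rV['F_p]_d -> 'rV[int]_d) (B : 'M[R]_d) :
  (0 < k)%N -> B \in unitmx ->
  (forall W : 'M['F_p]_d, (\rank W <= k)%N -> (#|[set i | (T i <= W)%MS]%SET| < r)%N) ->
  (forall v, exists2 m : 'F_p, m != 0 & map_mx intr (X v) = m *: v) ->
  exists S : seq 'rV[R]_d,
    [/\ uniq S, {in S, forall x, exists v, x = map_mx intr (X v) *m B},
        (M <= size S * r)%N &
        forall U : 'M[R]_(k, d), (count (fun v => (v <= U)%MS) S < r)%N].
Proof.
move=> k_gt0 B_unit T_few X_red.
pose f i := map_mx intr (X (T i)) *m B.
pose s := [seq f i | i : 'I_M].
have s_few (U : 'M[R]_(k, d)) : (count (fun v => (v <= U)%MS) s < r)%N.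
  (* [Z] keeps the coordinates of the points lying in [U] and is zero in the other rows. Over [R]
     the rows of [Z] times [B] lie in [U], so the rank of [Z] is at most [k], also modulo [p]. *)
  pose Z : 'M[int]_(M, d) :=
    \matrix_(i, j) if (f i <= U)%MS then X (T i) 0 j else 0.
  have rowZ (F : fieldType) i : (f i <= U)%MS ->
      row i (map_mx intr Z) = map_mx intr (X (T i)) :> 'rV[F]_d.
    by move=> fU; apply/rowP => j; rewrite !mxE fU.
  have rkZ : (\rank (map_mx intr Z : 'M['F_p]_(M, d)) <= k)%N.
    apply: leq_trans (mxrank_intr_le _ R _ _ Z) _.
    rewrite -(mxrankMfree _ (_ : row_free B)) ?row_free_unit //.
    apply: (leq_trans _ (rank_leq_row U)); apply/mxrankS/row_subP => i.
    rewrite row_mul; case fU: (f i <= U)%MS; first by rewrite rowZ.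
    have -> : row i (map_mx intr Z) = 0 :> 'rV[R]_d.
      by apply/rowP => j; rewrite !mxE fU.
    by rewrite mul0mx sub0mx.
  have := T_few <<map_mx intr Z>>%MS; rewrite mxrank_gen => /(_ rkZ).
  apply: leq_ltn_trans; rewrite count_map -size_filter cardE.
  rewrite uniq_leq_size ?filter_uniq -?enumT ?enum_uniq // => i.
  rewrite mem_filter => /andP[/= fU _]; rewrite mem_enum inE genmxE.
  have [m m_neq0 Xm] := X_red (T i).
  by rewrite -(eqmx_scale _ m_neq0) -Xm -rowZ // row_sub.
exists (undup s); split.
- exact: undup_uniq.
- by move=> x; rewrite mem_undup => /fintype.imageP[i _ ->]; exists (T i).
(* All repetitions of [x] lie in the row space of [k] copies of [x], so a point occurs fewer than
   [r] times; [0 < k] ensures that there is a copy. *)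
- rewrite -{1}(card_ord M) -(size_image f) size_leq_undup // => x.
  apply: leq_trans _ (ltnW (s_few (\matrix_(i < k) x))).
  apply: sub_count => y /= /eqP ->.
  by have := row_sub (Ordinal k_gt0) (\matrix_(i < k) x); rewrite rowK.
- move=> U; apply: leq_ltn_trans (s_few U).
  exact/leq_count_subseq/undup_subseq.
Qed.

(** * Choice of the prime and size of the family *)

Lemma truncn_ge_half (R : realType) (x : R) :
  1 <= x -> x / 2 <= (Num.truncn x)%:R.
Proof.
move=> x_ge1; have t_gt0 : (0 < Num.truncn x)%N by rewrite truncn_gt0.
have := truncnS_gt x; rewrite -natr1; have : 1 <= (Num.truncn x)%:R :> R by rewrite ler1n.
lra.
Qed.

(** With n about Y/2, 2^n <= (2n)^p gives n ln 2 <= p ln Y. Then delta ln Y <= Y^delta, from ln(1 +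
    t) <= t, replaces the logarithm by a small power. *)
Lemma exists_prime_near (R : realType) (delta : R) : 0 < delta ->
  exists2 c : R, 0 < c & forall Y : R, 2 <= Y ->
    exists p, [/\ prime p, p%:R <= Y & c * Y `^ (1 - delta) <= p%:R].
Proof.
move=> delta_gt0.
have ln2_gt0 : 0 < ln 2 :> R by rewrite ln_gt0 // ltr1n.
exists (delta * ln 2 / 4) => [|Y Y_ge2]; first by rewrite divr_gt0 ?mulr_gt0.
have Y_gt0 : 0 < Y by lra.
set n := Num.truncn (Y / 2).
have n_gt0 : (0 < n)%N by rewrite truncn_gt0; lra.
have n_leY : n%:R <= Y / 2 by rewrite truncn_le; lra.
have n_geY : Y / 4 <= n%:R.
  by have : 1 <= Y / 2 by [lra]; move=> /truncn_ge_half; rewrite -/n; lra.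
have n2_leY : n.*2%:R <= Y by rewrite -mul2n natrM; lra.
have [p [p_pr p_le n_le]] := exists_prime_expn_double n n_gt0.
exists p; split=> //; first by rewrite (le_trans _ n2_leY) // ler_nat.
have ln_le : n%:R * ln 2 <= p%:R * ln Y.
  have n2_gt0 : 0 < n.*2%:R :> R by rewrite ltr0n double_gt0.
  apply: (@le_trans _ _ (p%:R * ln n.*2%:R)); last first.
    by rewrite ler_wpM2l // ler_ln ?posrE.
  rewrite !mulr_natl -!lnXn // ler_ln ?posrE ?exprn_gt0 //.
  by rewrite -!natrX ler_nat.
have Yd_gt0 : 0 < Y `^ delta by exact: powR_gt0.
have lnY_le : delta * ln Y <= Y `^ delta.
  have := @le_ln1Dx R (Y `^ delta - 1); rewrite subrKC ln_powR ltrBDr addNr.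
  by move=> /(_ Yd_gt0); lra.
rewrite powRB ?(gt_eqF Y_gt0) ?implybT // powRr1 ?(ltW Y_gt0) // mulrA ler_pdivrMr //.
apply: (@le_trans _ _ (p%:R * (delta * ln Y))); last by rewrite ler_wpM2l.
have -> : delta * ln 2 / 4 * Y = delta * (Y / 4 * ln 2) by ring.
rewrite [X in _ <= X]mulrCA ler_pM2l // (le_trans _ ln_le) // ler_pM2r //.
Qed.

Lemma exists_few_in_subspace (R : realType) (d k : nat) (e : R) :
  (k < d)%N -> 0 < e < 1 ->
  exists2 r : nat, (0 < r)%N & forall p, prime p ->
    exists (M : nat) (T : {ffun 'I_M -> 'rV['F_p]_d}),
      p%:R `^ ((d - k)%:R - e) / 2 <= M%:R :> R /\
      forall W : 'M['F_p]_d, (\rank W <= k)%N -> (#|[set i | (T i <= W)%MS]%SET| < r)%N.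
Proof.
move=> lt_kd /andP[e_gt0 e_lt1].
(* This makes d^2 < e r, so that p^(d^2) p^((d-k-e)r) < p^((d-k)r) for every [p]. *)
set r := (Num.truncn ((d * d)%:R / e)).+1; exists r => // p p_pr.
have p_gt1 : 1 < p%:R :> R by rewrite ltr1n prime_gt1.
have p_gt0 : 0 < p%:R :> R by rewrite ltr0n prime_gt0.
have dk_ge1 : 1 <= (d - k)%:R :> R by rewrite ler1n subn_gt0.
pose x : R := p%:R `^ ((d - k)%:R - e).
have x_ge1 : 1 <= x.
  by rewrite -(powRr0 p%:R) ler_powR ?(ltW p_gt1) //; lra.
exists (Num.truncn x).
have [|T T_few] := @exists_ffun_few_in_subspace 'F_p d k r (Num.truncn x) (ltnW lt_kd).
  rewrite card_Fp // -(ltr_nat R) natrM !natrX.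
  apply: (@le_lt_trans _ _ (p%:R ^+ (d * d) * x ^+ r)).
    rewrite ler_pM2l ?exprn_gt0 //; apply: lerXn2r; rewrite ?nnegrE ?ler0n //.
      by rewrite (le_trans _ x_ge1).
    by rewrite truncn_le (le_trans _ x_ge1).
  rewrite -!powR_mulrn ?powR_ge0 ?(ltW p_gt0) // -powRrM -powRD ?(gt_eqF p_gt0) ?implybT //.
  rewrite /powR gt_eqF // ltr_expR ltr_pM2r ?ln_gt0 //.
  have r_gt : (d * d)%:R / e < r%:R by exact: truncnS_gt.
  rewrite ltr_pdivrMr // in r_gt.
  by rewrite [X in _ < X]natrM; lra.
by exists T; split=> //; exact: truncn_ge_half.
Qed.

(** * Short integer representatives of multiples of a vector *)

Lemma normalize_last_Fp (p n : nat) (v : 'rV['F_p]_n.+1) : prime p ->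
  exists2 m : 'F_p, m != 0 & exists2 x : 'rV[int]_n.+1,
    map_mx intr x = m *: v & (`|x 0%R ord_max| <= 1)%N /\ forall i, (`|x 0%R i| < p)%N.
Proof.
move=> p_pr.
have [m m_neq0 m_last] : exists2 m : 'F_p, m != 0 & ((m * v 0 ord_max)%R <= 1)%N.
  have [v0|v_neq0] := eqVneq (v 0 ord_max) 0.
    by exists 1; rewrite ?oner_eq0 // v0 mulr0.
  by exists (v 0 ord_max)^-1; rewrite ?invr_eq0 // mulVf.
exists m => //; exists (\row_i (m * v 0 i)%R%:Z).
  by apply/rowP => i; rewrite !mxE intr_val_Fp.
split=> [|i]; rewrite mxE //.
by rewrite -[X in (_ < X)%N](Fp_cast p_pr) ltn_ord.
Qed.

(* With [j] the first index such that [N j < p], the cells before [j] contribute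
   a factor [1] and the others at most [8 d p L i] each. *)
Lemma prod_cells_lt (R : realType) (d p : nat) (L : nat -> R) (N : nat -> nat) (beta : R) :
  (0 < d)%N -> (1 < p)%N -> 0 < beta -> p%:R <= beta / (128 * d%:R ^+ 2) ->
  (forall i, (i < d)%N -> (2 <= N i)%N) ->
  (forall i j, (i <= j < d)%N -> (N j <= N i)%N) ->
  (forall i, (i < d)%N -> (N i)%:R^-1 <= 4 * d%:R * L i) ->
  (forall j, (j.+1 < d)%N -> beta ^+ (d - j.+1) * \prod_(j <= i < d) L i <= 1) ->
  (\prod_(i < d) (p.-1 %/ N i).+1 < p)%N.
Proof.
move=> d_gt0 p_gt1 beta_gt0 p_le N_ge2 N_mono N_L beta_L.
rewrite -(big_mkord xpredT (fun i => (p.-1 %/ N i).+1)).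
have cell1 i : (p <= N i)%N -> (p.-1 %/ N i).+1 = 1%N.
  by move=> le_pN; rewrite divn_small //; case: p p_gt1 le_pN {p_le}.
case: (pickP [pred i : 'I_d | N i < p]%N) => [i0 Ni0|no_small]; last first.
  rewrite big_nat big1 // => i /andP[_ lt_id]; rewrite cell1 //.
  by have /negbT := no_small (Ordinal lt_id); rewrite /= -leqNgt.
have ex_small : exists j, (j < d)%N && (N j < p)%N by exists i0; rewrite ltn_ord.
case: (ex_minnP ex_small) => j /andP[lt_jd Nj] j_min.
rewrite (@big_cat_nat _ _ _ j) ?(ltnW lt_jd) //= big_nat big1 ?mul1n => [|i /andP[_ lt_ij]]; last first.
  apply: cell1; rewrite leqNgt; apply/negP => Ni.
  by have := j_min i; rewrite (ltn_trans lt_ij lt_jd) Ni leqNgt lt_ij => /(_ isT).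
(* [beta_L] says nothing about the last index alone. There a single factor remains, and [2 <= N j]
   bounds it by (p-1)/2 + 1 < p. *)
have [lt_j1d|] := ltnP j.+1 d; last first.
  move=> le_dj; have -> : d = j.+1 by apply/eqP; rewrite eqn_leq le_dj.
  rewrite big_nat1; have := N_ge2 j lt_jd; move: (N j) => a a_ge2.
  have : (p.-1 %/ a <= p.-1 %/ 2)%N by rewrite leq_div2l.
  lia.
have p_gt0 : 0 < p%:R :> R by rewrite ltr0n ltnW.
have d_gt0R : 0 < d%:R :> R by rewrite ltr0n.
have d_ge1 : 1 <= d%:R :> R by rewrite ler1n.
rewrite -(ltr_nat R) natr_prod.
apply: (@le_lt_trans _ _ (\prod_(j <= i < d) (8 * d%:R * p%:R * L i))).
  rewrite big_nat [X in _ <= X]big_nat; apply: ler_prod => i /andP[le_ji lt_id].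
  rewrite ler0n /=.
  have Ni_lt : (N i < p)%N by rewrite (leq_ltn_trans _ Nj) // N_mono // le_ji.
  have Ni_gt0 : 0 < (N i)%:R :> R by rewrite ltr0n (leq_trans _ (N_ge2 i lt_id)).
  apply: (@le_trans _ _ (2 * p%:R * (N i)%:R^-1)); last first.
    have := N_L i lt_id; nra.
  rewrite -ler_pdivrMr ?invr_gt0 // invrK -natrM -natrM ler_nat mulSn.
  have := leq_trunc_div p.-1 (N i); lia.
rewrite big_split /= prodr_const_nat.
have d_j : (d - j = (d - j.+1).+1)%N by lia.
have := beta_L j lt_j1d; rewrite d_j; set m := (d - j.+1)%N.
have m_gt0 : (0 < m)%N by rewrite subn_gt0.
set PL := \prod_(j <= i < d) L i => PL_le.
have PL_le' : PL <= (beta ^+ m)^-1 by rewrite -[_^-1]mul1r ler_pdivlMr ?exprn_gt0 // mulrC.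
set a := 8 * d%:R * p%:R; have a_gt0 : 0 < a by rewrite !mulr_gt0.
apply: (@le_lt_trans _ _ (a ^+ m.+1 * (beta ^+ m)^-1)).
  by rewrite ler_wpM2l // exprn_ge0 // ltW.
rewrite exprS -mulrA -exprVn -exprMn.
(* The product is at most a (a/beta)^m with a = 8dp. The constant 128 gives a/beta <= 1/(16d), and
   as m >= 1 one such factor already brings [a] down to p/2. *)
have q_le : a * beta^-1 <= (16 * d%:R)^-1.
  rewrite ler_pdivrMr //; move: p_le; rewrite ler_pdivlMr ?mulr_gt0 ?exprn_gt0 //.
  rewrite -[_^-1 * _]mulrC ler_pdivlMr ?mulr_gt0 // /a expr2; nra.
have q_ge0 : 0 <= a * beta^-1 by rewrite mulr_ge0 ?invr_ge0 ?ltW.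
have q_le1 : a * beta^-1 <= 1.
  by rewrite (le_trans q_le) // invf_le1 ?mulr_gt0 //; lra.
have qm_le : (a * beta^-1) ^+ m <= (16 * d%:R)^-1.
  apply: le_trans q_le; rewrite -[X in _ <= X]expr1.
  by rewrite ler_wiXn2l.
apply: (@le_lt_trans _ _ (a * (16 * d%:R)^-1)); first by rewrite ler_pM2l.
by rewrite ltr_pdivrMr ?mulr_gt0 // /a; nra.
Qed.

(** Here [L i] stands for lambda_(i+1) and [mu i] for the radius of a dilate of [K] containing the
    (i+1)st chosen vector. The weighted sum is then the radius of a dilate containing the
    combination with coefficients [x]. *)
Lemma short_multiple_Fp (R : realType) (n p : nat) (L mu : nat -> R) (beta : R)
    (v : 'rV['F_p]_n.+2) :
  prime p -> 0 < beta -> L n.+1 < 1 ->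
  (forall i, (i < n.+2)%N -> 0 < L i) ->
  (forall i j, (i <= j < n.+2)%N -> L i <= L j) ->
  (forall j, (j < n.+1)%N ->
    beta ^+ (n.+1 - j) * \prod_(j <= i < n.+2) L i <= 1) ->
  p%:R <= (1 - L n.+1) * beta / (128 * n.+2%:R ^+ 2) ->
  (forall i, (i < n.+2)%N -> 0 <= mu i <= 2 * L i) ->
  mu n.+1 <= (1 + L n.+1) / 2 ->
  exists2 m : 'F_p, m != 0 & exists2 x : 'rV[int]_n.+2,
    map_mx intr x = m *: v & \sum_(i < n.+2) `|x 0%R i|%N%:R * mu i <= 1.
Proof.
move=> p_pr beta_gt0 Llast_lt1 L_gt0 L_mono beta_L p_le mu_le mu_last.
set d : R := n.+2%:R; have d_ge2 : 2 <= d by rewrite ler_nat.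
have Llast_gt0 : 0 < L n.+1 by exact: L_gt0.
have [L_large|L_small] := lerP (4 * d)^-1 (L n.+1).
  have [m m_neq0 [x xm [x_last x_lt]]] := normalize_last_Fp p _ v p_pr.
  exists m => //; exists x => //; rewrite big_ord_recr /=.
  have LL : beta * (L n * L n.+1) <= 1.
    have := beta_L n (ltnSn n); rewrite subSnn expr1.
    by rewrite big_nat_recr //= big_nat1.
  have L_n_gt0 : 0 < L n by exact: L_gt0.
  have head_le : \sum_(i < n.+1) `|x 0%R (widen_ord (leqnSn n.+1) i)|%N%:R * mu i
      <= \sum_(i < n.+1) 2 * p%:R * L n.
    apply: ler_sum => i _; have lt_i := ltn_ord i.
    have /andP[mu_ge0 mu_le2] := mu_le i (leqW lt_i).
    have := L_mono i n; rewrite -ltnS lt_i leqW // => /(_ isT) L_le.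
    have := x_lt (widen_ord (leqnSn n.+1) i).
    move/ltnW; rewrite -(ler_nat R) => x_le.
    have : 0 <= `|x 0%R (widen_ord (leqnSn n.+1) i)|%N%:R :> R by [].
    move: x_le; move: (_%:R) (p%:R) => a b; nra.
  rewrite sumr_const card_ord -[_ *+ n.+1]mulr_natr in head_le.
  have last_le : `|x 0%R ord_max|%N%:R * mu n.+1 <= (1 + L n.+1) / 2.
    have /andP[mu_ge0 _] := mu_le n.+1 (ltnSn _).
    apply: le_trans mu_last; rewrite ler_piMl //.
    by rewrite (_ : 1 = 1%:R) // ler_nat.
  have n_eq : n.+1%:R = d - 1 :> R by rewrite /d -[n.+2%:R]natr1; lra.
  have p_le' : p%:R * (128 * d ^+ 2) <= (1 - L n.+1) * beta.
    by rewrite -ler_pdivlMr // mulr_gt0 ?exprn_gt0 //; lra.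
  (* From beta lambda_(d-1) lambda_d <= 1 and lambda_d >= 1/(4d). The first d-1 coordinates then
     cost at most (1 - lambda_d)/16 in total, while the last one leaves (1 - lambda_d)/2. *)
  have betaL : beta * L n <= 4 * d.
    have L4 : 1 <= 4 * d * L n.+1.
      by rewrite -ler_pdivrMl ?mulr1 //; lra.
    have : beta * L n * 1 <= beta * L n * (4 * d * L n.+1).
      by rewrite ler_wpM2l // mulr_ge0 ?ltW.
    have : beta * (L n * L n.+1) * (4 * d) <= 1 * (4 * d) by rewrite ler_wpM2r //; lra.
    lra.
  have : p%:R * L n * (32 * d) <= 1 - L n.+1.
    have : p%:R * (128 * d ^+ 2) * L n <= (1 - L n.+1) * (4 * d).
      apply: (@le_trans _ _ ((1 - L n.+1) * (beta * L n))).
        by rewrite [X in _ <= X]mulrA ler_wpM2r // ltW.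
      by rewrite ler_wpM2l //; lra.
    rewrite (_ : p%:R * (128 * d ^+ 2) * L n = p%:R * L n * (32 * d) * (4 * d)); last by ring.
    by rewrite ler_pM2r //; lra.
  have : 0 <= p%:R * L n by rewrite mulr_ge0 // ltW.
  rewrite n_eq in head_le; move: head_le last_le.
  move: (\sum_(i < n.+1) _) (_ * mu n.+1) => s1 s2.
  rewrite -(mulrA 2); move: (p%:R * L n) => a; nra.
(* A coordinate of size at most [N i] costs at most N i * 2 L i <= 1/d, and L i < 1/(4d) makes [N i]
   at least 2. *)
pose N i := Num.truncn ((2 * d * L i)^-1).
have invL_ge2 i : (i < n.+2)%N -> 2 <= (2 * d * L i)^-1.
  move=> lt_i; have Li_gt0 := L_gt0 i lt_i.
  have L_le : L i <= L n.+1 by rewrite L_mono // -ltnS lt_i ltnSn.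
  have dL_gt0 : 0 < 2 * d * L i by rewrite !mulr_gt0 //; lra.
  rewrite -[_^-1]mul1r ler_pdivlMr //.
  have : 4 * d * L n.+1 <= 1.
    by rewrite mulrC -ler_pdivlMr ?mul1r ?(ltW L_small) //; lra.
  have : 4 * d * L i <= 4 * d * L n.+1 by rewrite ler_wpM2l //; lra.
  lra.
have N_ge2 i : (i < n.+2)%N -> (2 <= N i)%N.
  by move=> /invL_ge2 ge2; rewrite truncn_ge_nat // (le_trans _ ge2).
have prod_lt : (\prod_(i < n.+2) (p.-1 %/ N i).+1 < p)%N.
  apply: (@prod_cells_lt R n.+2 p L N beta) => //.
  - exact: prime_gt1.
  - apply: le_trans p_le _; rewrite ler_pM2r; last first.
      by rewrite invr_gt0 mulr_gt0 ?exprn_gt0 // ltr0n.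
    by rewrite ler_piMl ?(ltW beta_gt0) //; lra.
  - move=> i j /andP[le_ij lt_j]; apply: le_truncn.
    have Li_gt0 := L_gt0 i (leq_ltn_trans le_ij lt_j); have Lj_gt0 := L_gt0 j lt_j.
    rewrite lef_pV2 ?posrE ?mulr_gt0 //; try lra.
    by rewrite ler_pM2l ?L_mono ?le_ij //; lra.
  - move=> i lt_i; have Li_gt0 := L_gt0 i lt_i.
    have Ni_gt0 : 0 < (N i)%:R :> R by rewrite ltr0n (leq_trans _ (N_ge2 i lt_i)).
    have dL_gt0 : 0 < 2 * d * L i by rewrite !mulr_gt0 //; lra.
    have : (2 * d * L i)^-1 / 2 <= (N i)%:R.
      by apply: truncn_ge_half; rewrite (le_trans _ (invL_ge2 i lt_i)) // ler1n.
    rewrite -invfM => half_le; rewrite -[X in _ <= X]invrK lef_pV2 ?posrE ?invr_gt0 //.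
      by apply: le_trans half_le; rewrite le_eqVlt; apply/orP; left; apply/eqP; congr _^-1; ring.
    by rewrite !mulr_gt0 //; lra.
have N_gt0 (i : 'I_n.+2) : (0 < N i)%N by exact: ltnW (N_ge2 i (ltn_ord i)).
have [m m_neq0 [x xm x_le]] := dirichlet_Fp p n.+2 N v p_pr N_gt0 prod_lt.
exists m => //; exists x => //.
apply: (@le_trans _ _ (\sum_(i < n.+2) d^-1)); last first.
  by rewrite sumr_const card_ord -[_ *+ _]mulr_natr mulVf // gt_eqF; lra.
apply: ler_sum => i _; have Li_gt0 := L_gt0 i (ltn_ord i).
have dL_gt0 : 0 < 2 * d * L i by rewrite !mulr_gt0 //; lra.
have /andP[mu_ge0 mu_le2] := mu_le i (ltn_ord i).
apply: (@le_trans _ _ ((2 * d * L i)^-1 * (2 * L i))).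
  apply: ler_pM => //.
  have : (N i)%:R <= (2 * d * L i)^-1 by rewrite truncn_le invr_ge0 ltW.
  by apply: le_trans; rewrite ler_nat x_le.
by rewrite le_eqVlt; apply/orP; left; apply/eqP; field; rewrite !gt_eqF //; lra.
Qed.

(** * Dilates of a symmetric convex set *)

Lemma convex_set_combination (R : realType) (d : nat) (K : set 'rV[R]_d) (x y : 'rV[R]_d) (a b : R) :
  convex_set K -> K x -> K y -> 0 <= a -> 0 <= b -> a + b = 1 -> K (a *: x + b *: y).
Proof.
move=> K_conv Kx Ky a_ge0 b_ge0 ab1.
have a_le1 : a <= 1 by lra.
have := K_conv x y (Itv01 a_ge0 a_le1); rewrite !inE => /(_ Kx Ky).
by rewrite (_ : b = 1 - a) //; lra.
Qed.

Lemma symmetric_convex_set0 (R : realType) (d : nat) (K : set 'rV[R]_d) :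
  convex_set K -> symmetric_set K -> K !=set0 -> K 0.
Proof.
move=> K_conv K_sym [x Kx].
have -> : 0 = 2^-1 *: x + 2^-1 *: (- x) by rewrite scalerN subrr.
by apply: convex_set_combination => //; [exact: K_sym | lra].
Qed.

Lemma dilateD (R : realType) (d : nat) (K : set 'rV[R]_d) (a b : R) (x y : 'rV[R]_d) :
  convex_set K -> 0 <= a -> 0 <= b ->
  dilate a K x -> dilate b K y -> dilate (a + b) K (x + y).
Proof.
move=> K_conv a_ge0 b_ge0 [x' Kx' <-] [y' Ky' <-].
have [ab_gt0|] := ltP 0 (a + b); last first.
  move=> ab_le0; have -> : a = 0 by lra.
  have -> : b = 0 by lra.
  by exists x' => //; rewrite addr0 !scale0r addr0.
exists ((a / (a + b)) *: x' + (b / (a + b)) *: y'); last first.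
  rewrite scalerDr !scalerA; congr (_ *: _ + _ *: _); field; exact: lt0r_neq0.
apply: convex_set_combination => //; try by rewrite divr_ge0 // ltW.
by rewrite -mulrDl divff // gt_eqF.
Qed.

Lemma dilateZ (R : realType) (d : nat) (K : set 'rV[R]_d) (a l : R) (x : 'rV[R]_d) :
  symmetric_set K -> dilate l K x -> dilate (`|a| * l) K (a *: x).
Proof.
move=> K_sym [y Ky <-]; have [a_ge0|a_lt0] := leP 0 a.
  by exists y => //; rewrite ger0_norm // scalerA.
exists (- y); first exact: K_sym.
by rewrite ltr0_norm // scalerN -scaleNr mulNr opprK scalerA.
Qed.

Lemma dilate_le (R : realType) (d : nat) (K : set 'rV[R]_d) (a b : R) :
  convex_set K -> symmetric_set K -> 0 <= a <= b -> dilate a K `<=` dilate b K.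
Proof.
move=> K_conv K_sym /andP[a_ge0 le_ab] x ax.
have K0 : K 0 by apply: symmetric_convex_set0 => //; case: ax => y; exists y.
rewrite -[x]addr0 -(subrKC a b); apply: dilateD => //; first by rewrite subr_ge0.
by exists 0; rewrite ?scaler0.
Qed.

Lemma dilate_sum (R : realType) (d : nat) (K : set 'rV[R]_d) (n : nat)
    (l : 'I_n -> R) (x : 'I_n -> 'rV[R]_d) :
  convex_set K -> K 0 -> (forall i, 0 <= l i) -> (forall i, dilate (l i) K (x i)) ->
  dilate (\sum_i l i) K (\sum_i x i).
Proof.
move=> K_conv K0 l_ge0 lx.
suff [] : 0 <= \sum_i l i /\ dilate (\sum_i l i) K (\sum_i x i) by [].
apply: (big_ind2 (fun a y => 0 <= a /\ dilate a K y)).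
- by split=> //; exists 0; rewrite ?scaler0.
- by move=> a x1 b x2 [a0 ax1] [b0 bx2]; split; [exact: addr_ge0 | exact: dilateD].
- by move=> i _.
Qed.

(** * Independent vectors from affine dimension *)

Lemma affdim_geS (R : realType) (d : nat) (A : set 'rV[R]_d) (i : nat) :
  affdim_ge A i.+1 -> affdim_ge A i.
Proof.
move=> [a0 [M [Aa0 [AM M_free]]]].
pose M' : 'M[R]_(1 + i, d) := M; exists a0, (dsubmx M'); split=> //; split=> [j|].
  by rewrite row_dsubmx; exact: AM.
rewrite /row_free eqn_leq rank_leq_row /=.
have : \rank M' = i.+1 by exact/eqP.
rewrite -{1}[M']vsubmxK -addsmxE => rkM.
have := mxrank_adds_leqif (usubmx M') (dsubmx M'); rewrite rkM => -[rk_le _].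
by have := rank_leq_row (usubmx M'); lia.
Qed.

Lemma affdim_ge_notin_sub (R : realType) (d m i : nat) (A : set 'rV[R]_d) (U : 'M[R]_(m, d)) :
  affdim_ge A i -> (\rank U < i)%N -> exists2 x, A x & ~~ (x <= U)%MS.
Proof.
move=> [a0 [M [Aa0 [AM M_free]]]] rkU; apply/not_exists2P => A_sub.
have in_U x : A x -> (x <= U)%MS.
  by move=> Ax; case: (A_sub x) => // /negP; rewrite negbK.
suff : (M <= U)%MS by move=> /mxrankS; rewrite (eqP M_free) leqNgt rkU.
apply/row_subP => j.
by rewrite -[row j M](addKr a0) addmx_sub ?eqmx_opp ?in_U.
Qed.

(** Greedy choice: the first [n] vectors span a subspace of dimension at most [n], which cannot
    contain [A n], a set of affine dimension at least n+1. *)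
Lemma exists_unitmx_rows (R : realType) (d : nat) (A : nat -> set 'rV[R]_d) :
  (forall i, (i < d)%N -> affdim_ge (A i) i.+1) ->
  exists2 M : 'M[R]_d, M \in unitmx & forall i : 'I_d, A i (row i M).
Proof.
move=> A_dim.
have free_family n : (n <= d)%N -> exists2 b : nat -> 'rV[R]_d,
    row_free (\matrix_(i < n) b i) & forall i, (i < n)%N -> A i (b i); last first.
  have [b b_free bA] := free_family d (leqnn d).
  exists (\matrix_(i < d) b i); first by rewrite -row_free_unit.
  by move=> i; rewrite rowK; exact: bA.
elim: n => [|n IHn] lt_nd.
  by exists (fun=> 0) => //; rewrite /row_free -leqn0 rank_leq_row.
have [b b_free bA] := IHn (ltnW lt_nd); set M := \matrix_(i < n) b i in b_free.
have [x Ax xM] : exists2 x, A n x & ~~ (x <= M)%MS.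
  by apply: affdim_ge_notin_sub (A_dim n lt_nd) _; rewrite ltnS rank_leq_row.
exists (fun i => if i == n then x else b i); last first.
  move=> i; rewrite ltnS leq_eqVlt; case: eqP => [->|_] //=; exact: bA.
set M' := \matrix_(i < n.+1) _.
have MM' : (M < M')%MS.
  rewrite ltmxE; apply/andP; split; last first.
    apply: contra xM => M'M; apply: submx_trans M'M.
    have -> : x = row ord_max M' by rewrite rowK /= eqxx.
    exact: row_sub.
  apply/row_subP => i.
  have -> : row i M = row (widen_ord (leqnSn n) i) M'.
    by rewrite !rowK /= ltn_eqF.
  exact: row_sub.
rewrite /row_free eqn_leq rank_leq_row.
by have := rank_ltmx MM'; rewrite (eqP b_free).
Qed.

Lemma lattice_mulmx (R : realType) (d : nat) (B M : 'M[R]_d) (z : 'rV[int]_d) :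
  (forall i, lattice B (row i M)) -> lattice B (map_mx intr z *m M).
Proof.
move=> /choice[Z MZ]; exists (z *m \matrix_i Z i).
rewrite map_mxM -mulmxA; congr (_ *m _); apply/row_matrixP => i.
by rewrite MZ row_mul; congr (_ *m _); apply/rowP => j; rewrite !mxE.
Qed.

(** * Successive minima and the quantity beta *)

Section SuccMin.
Variables (R : realType) (d : nat) (B : 'M[R]_d) (K : set 'rV[R]_d).

Let dilates i := [set l : R | 0 < l /\ affdim_ge (lattice B `&` dilate l K) i].

Let dilates_lb i : lbound (dilates i) 0.
Proof. by move=> l [/ltW]. Qed.

Lemma succ_min_ge0 i : 0 <= succ_min B K i.
Proof.
have [ne|] := pselect (dilates i !=set0); first exact: lb_le_inf ne (@dilates_lb i).
by move=> /nonemptyPn E0; rewrite /succ_min -/(dilates i) E0 inf0.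
Qed.

(* [inf] is [0] on the empty set. *)
Lemma succ_min_gt0_ex i : 0 < succ_min B K i -> dilates i !=set0.
Proof.
move=> gt0; apply/set0P; apply: contraTneq gt0 => E0.
by rewrite /succ_min -/(dilates i) E0 inf0 ltxx.
Qed.

Lemma succ_minS i : 0 < succ_min B K i.+1 -> succ_min B K i <= succ_min B K i.+1.
Proof.
move=> /succ_min_gt0_ex ne; apply: lb_le_inf => // l [l_gt0 dim_l].
by apply: ge_inf; [exists 0; exact: dilates_lb | split=> //; exact: affdim_geS].
Qed.

(** A radius strictly above the infimum exceeds some admissible radius, and the dilates are
    nested. *)
Lemma affdim_ge_dilate i l : convex_set K -> symmetric_set K ->
  0 < succ_min B K i < l -> affdim_ge (lattice B `&` dilate l K) i.
Proof.
move=> K_conv K_sym /andP[gt0 lt_l].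
have [m [m_gt0 [a0 [M [[La0 Da0] [LDM M_free]]]]] lt_ml] :=
  inf_lt (succ_min_gt0_ex _ gt0) lt_l.
have sub : dilate m K `<=` dilate l K by apply: dilate_le; rewrite // !ltW.
exists a0, M; split; first by split=> //; exact: sub.
by split=> // j; have [LM DM] := LDM j; split=> //; exact: sub.
Qed.

Lemma beta_min_ge0 : 0 <= beta_min B K.
Proof.
by rewrite /beta_min le_bigmin // => [|i _]; exact: powR_ge0.
Qed.

Lemma beta_min_le j : (1 <= j < d)%N -> beta_min B K <=
  powR (\prod_(j <= i < d.+1) succ_min B K i) (- (1 / (d - j)%:R)).
Proof. by move=> j_lt; apply: ge_bigmin_seq => //; rewrite mem_index_iota. Qed.

(* [powR 0 s] is [0] even for [s < 0], so a vanishing minimum makes the bound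
   of the theorem trivial and no discreteness of the lattice is needed. *)
Lemma beta_min_eq0 i : (1 < d)%N -> (1 <= i <= d)%N -> succ_min B K i = 0 ->
  beta_min B K = 0.
Proof.
move=> d_gt1 i_le i0; apply/eqP; rewrite eq_le beta_min_ge0 andbT.
apply: le_trans (beta_min_le 1 _) _; first by rewrite d_gt1.
have -> : \prod_(1 <= j < d.+1) succ_min B K j = 0.
  apply/eqP; rewrite prodf_seq_eq0; apply/hasP; exists i; last by rewrite i0 eqxx.
  by rewrite mem_index_iota ltnS.
by rewrite powR0 // oppr_eq0 mul1r invr_eq0 pnatr_eq0 -lt0n subn_gt0.
Qed.

(** Raising beta <= P^(-1/(d-j)) to the power d-j removes the fractional exponent. *)
Lemma beta_min_prod_le1 j : (1 <= j < d)%N ->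
  (forall i, (1 <= i <= d)%N -> 0 < succ_min B K i) ->
  beta_min B K ^+ (d - j) * \prod_(j <= i < d.+1) succ_min B K i <= 1.
Proof.
move=> j_lt pos; set P := \prod_(j <= i < d.+1) _.
have P_gt0 : 0 < P.
  rewrite /P big_nat; apply: prodr_gt0 => i /andP[le_ji]; rewrite ltnS => le_id.
  by apply: pos; rewrite le_id andbT; case/andP: j_lt => /leq_trans ->.
rewrite -ler_pdivlMr // mul1r.
have dj_gt0 : (0 < d - j)%N by rewrite subn_gt0; case/andP: j_lt.
apply: (@le_trans _ _ (powR P (- (1 / (d - j)%:R)) ^+ (d - j))).
  by rewrite lerXn2r ?nnegrE ?powR_ge0 ?beta_min_ge0 // beta_min_le.
rewrite -powR_mulrn ?powR_ge0 // -powRrM mulNr mul1r mulVf ?pnatr_eq0 -?lt0n //.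
by rewrite powR_inv1 // ltW.
Qed.

End SuccMin.

(** * Construction of the point set *)

(** This is the triangle inequality for the gauge of [K], phrased with dilates. *)
Lemma mulmx_in_convex (R : realType) (d : nat) (K : set 'rV[R]_d) (M : 'M[R]_d)
    (mu : nat -> R) (z : 'rV[int]_d) :
  convex_set K -> symmetric_set K -> K 0 ->
  (forall i : 'I_d, 0 <= mu i) -> (forall i : 'I_d, dilate (mu i) K (row i M)) ->
  \sum_(i < d) `|z 0%R i|%N%:R * mu i <= 1 -> K (map_mx intr z *m M).
Proof.
move=> K_conv K_sym K0 mu_ge0 M_mu z_le1.
have z_ge0 : 0 <= \sum_(i < d) `|z 0%R i|%N%:R * mu i.
  by apply: sumr_ge0 => i _; rewrite mulr_ge0.
suff /(@dilate_le _ _ _ _ 1 K_conv K_sym) : dilate (\sum_(i < d) `|z 0%R i|%N%:R * mu i) K (map_mx intr z *m M).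
  by rewrite z_ge0 => /(_ z_le1) [y Ky <-]; rewrite scale1r.
rewrite mulmx_sum_row; apply: dilate_sum => // i; first by rewrite mulr_ge0.
by rewrite mxE natr_absz intr_norm; exact: dilateZ.
Qed.

Lemma exists_many_few_in_subspace (R : realType) (n k r m p : nat) (B : 'M[R]_n.+2)
    (K : set 'rV[R]_n.+2) (T : {ffun 'I_m -> 'rV['F_p]_n.+2}) :
  (0 < k)%N -> prime p ->
  convex_set K -> symmetric_set K -> succ_min B K n.+2 < 1 -> 0 < beta_min B K ->
  p%:R <= (1 - succ_min B K n.+2) * beta_min B K / (128 * n.+2%:R ^+ 2) ->
  (forall W : 'M['F_p]_n.+2, (\rank W <= k)%N -> (#|[set i | (T i <= W)%MS]%SET| < r)%N) ->
  exists S : seq 'rV[R]_n.+2,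
    [/\ uniq S, {subset S <= lattice B `&` K}, (m <= size S * r)%N &
        forall U : 'M[R]_(k, n.+2), (count (fun v => (v <= U)%MS) S < r)%N].
Proof.
move=> k_gt0 p_pr K_conv K_sym last_lt1 beta_gt0 p_le T_few.
have succ_gt0 i : (1 <= i <= n.+2)%N -> 0 < succ_min B K i.
  move=> i_le; rewrite lt_neqAle succ_min_ge0 andbT eq_sym.
  apply/eqP => i0; move: beta_gt0.
  by rewrite (beta_min_eq0 _ _ _ _ i) ?ltxx.
pose L i := succ_min B K i.+1.
have L_gt0 i : (i < n.+2)%N -> 0 < L i by move=> lt_i; exact: succ_gt0.
(* The radii must exceed the minima strictly for [affdim_ge_dilate]. The last one is also kept at
   most (1 + lambda_d)/2 < 1, so that a coefficient of absolute value 1 leaves room inside [K]. *)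
pose mu i := if i == n.+1 then Num.min (2 * L i) ((1 + L i) / 2) else 2 * L i.
have mu_gt i : (i < n.+2)%N -> L i < mu i.
  move=> lt_i; have := L_gt0 i lt_i; rewrite /mu; case: eqP => [-> | _]; last lra.
  by move=> ?; rewrite lt_min; apply/andP; split; rewrite /L; lra.
have [M M_unit M_in] : exists2 M : 'M[R]_n.+2, M \in unitmx &
    forall i : 'I_n.+2, (lattice B `&` dilate (mu i) K) (row i M).
  apply: (@exists_unitmx_rows _ _ (fun i => lattice B `&` dilate (mu i) K)) => i lt_i.
  by apply: affdim_ge_dilate => //; rewrite mu_gt // andbT; exact: L_gt0.
have mu_ge0 i : (i < n.+2)%N -> 0 <= mu i.
  by move=> lt_i; rewrite (le_trans _ (ltW (mu_gt i lt_i))) // ltW // L_gt0.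
have K0 : K 0.
  apply: symmetric_convex_set0 => //; have [_ [y Ky _]] := M_in ord0.
  by exists y.
have short v := @short_multiple_Fp R n p L mu (beta_min B K) v p_pr beta_gt0 last_lt1 L_gt0.
have {}short (v : 'rV['F_p]_n.+2) : exists x : 'rV[int]_n.+2,
    (exists2 a : 'F_p, a != 0 & map_mx intr x = a *: v) /\
    \sum_(i < n.+2) `|x 0%R i|%N%:R * mu i <= 1.
  case: (short v) => // [i j /andP[le_ij lt_j]|j lt_j|i lt_i||a a_neq0 [x xa x_le]].
  - elim: j le_ij lt_j => [|j IHj]; first by rewrite leqn0 => /eqP ->.
    rewrite leq_eqVlt => /predU1P[-> //|]; rewrite ltnS => le_ij lt_j.
    by rewrite (le_trans (IHj le_ij (ltnW lt_j))) // succ_minS // succ_gt0.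
  - by have := beta_min_prod_le1 _ _ B K j.+1 lt_j succ_gt0; rewrite big_add1 subSS.
  - rewrite mu_ge0 //= /mu; case: eqP => // _; by rewrite ge_min lexx.
  - by rewrite /mu eqxx ge_min lexx orbT.
  - by exists x; split=> //; exists a.
have [X X_short] := choice short.
have [S [S_uniq S_X size_S S_few]] := lift_few_in_subspace R p _ k r m T X M k_gt0 M_unit
  T_few (fun v => (X_short v).1).
exists S; split=> // _ /S_X[v ->]; rewrite inE; split.
  by apply: lattice_mulmx => i; have [] := M_in i.
apply: (mulmx_in_convex _ _ _ _ mu) => //; last by case: (X_short v).
  by move=> i; exact: mu_ge0.
by move=> i; have [] := M_in i.
Qed.

Theorem theorem4 (R : realType) (d k : nat) (eps : R) :
  (1 <= k)%N -> (k <= d - 1)%N -> 0 < eps < 1 ->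
  exists (r : nat), (0 < r)%N /\
  exists c : R, 0 < c /\
  forall (B : 'M[R]_d) (K : set 'rV[R]_d),
    is_lattice_basis B ->
    compact K -> convex_set K -> symmetric_set K -> interior K !=set0 ->
    succ_min B K d <= 1 ->
    exists S : seq 'rV[R]_d,
      uniq S /\ {subset S <= lattice B `&` K} /\
      c * powR ((1 - succ_min B K d) * beta_min B K) ((d - k)%:R - eps)
        <= (size S)%:R /\
      forall U : 'M[R]_(k, d), \rank U = k ->
        (count (fun v => (v <= U)%MS) S <= r - 1)%N.
Proof.
case: d => [|[|n]] k_gt0; [by lia | by lia | rewrite subn1 /= => le_kn].
set d := n.+2 => /andP[eps_gt0 eps_lt1].
have lt_kd : (k < d)%N by [].
(* Half of [eps] is spent on the random family, the other half on the gap between [p] and its upper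
   bound. *)
have eps2 : 0 < eps / 2 < 1 by lra.
have [r r_gt0 few_Fp] := exists_few_in_subspace R d k (eps / 2) lt_kd eps2.
have d_ge2 : 2 <= d%:R :> R by rewrite ler_nat.
have delta_gt0 : 0 < eps / (2 * d%:R) by rewrite divr_gt0 ?mulr_gt0 //; lra.
have [c0 c0_gt0 prime_near] := exists_prime_near R _ delta_gt0.
have D_ge1 : 1 <= (d - k)%:R :> R by rewrite ler1n subn_gt0.
have D_le : (d - k)%:R <= d%:R :> R by rewrite ler_nat leq_subr.
set D : R := (d - k)%:R in few_Fp D_ge1 D_le *.
pose C : R := 128 * d%:R ^+ 2.
have C_gt0 : 0 < C by rewrite mulr_gt0 ?exprn_gt0 //; lra.
have r_gt0R : 0 < r%:R :> R by rewrite ltr0n.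
pose c1 := powR (2 * C) (D - eps).
(* The losses are [c0] from the prime, 2 from truncating the family size, [r] from repeated points,
   and a power of [C] from rescaling [x]. *)
pose c2 := powR c0 (D - eps / 2) / (2 * r%:R * powR C (D - eps)).
have c1_gt0 : 0 < c1 by apply: powR_gt0; rewrite mulr_gt0.
have c2_gt0 : 0 < c2 by rewrite divr_gt0 ?mulr_gt0 ?powR_gt0.
(* The successor leaves room for the one-point set used when [x] is small, even if [r] is 1. *)
exists r.+1; split=> //; exists (Num.min c1^-1 c2); split.
  by rewrite lt_min invr_gt0 c1_gt0.
move=> B K _ _ K_conv K_sym K_ne last_le1; rewrite subn1 /=.
have beta_ge0 := beta_min_ge0 _ _ B K.
set x := (1 - _) * _; have x_ge0 : 0 <= x by rewrite mulr_ge0 // subr_ge0.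
(* [prime_near] requires x/C >= 2. Below that the bound to reach is at most 1, and the origin alone
   suffices. *)
have [x_lt|x_ge] := ltP x (2 * C).
  have K0 : K 0.
    by apply: symmetric_convex_set0 => //; case: K_ne => y /interior_subset; exists y.
  exists [:: 0]; split=> //; split.
    move=> y; rewrite mem_seq1 => /eqP ->; rewrite inE; split=> //.
    by exists 0; rewrite map_mx0 mul0mx.
  split=> [|U _]; last by rewrite /= sub0mx.
  apply: (@le_trans _ _ (c1^-1 * c1)); last by rewrite mulVf // gt_eqF.
  apply: ler_pM; rewrite ?powR_ge0 ?ge_min ?lexx //.
    by rewrite le_min invr_ge0 !ltW.
  by rewrite ge0_ler_powR ?nnegrE ?(ltW x_lt) ?mulr_ge0 ?(ltW C_gt0) //; lra.
have x_gt0 : 0 < x by apply: lt_le_trans x_ge; rewrite mulr_gt0.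
have [last_lt1 beta_gt0] : succ_min B K d < 1 /\ 0 < beta_min B K.
  rewrite lt_neqAle last_le1 andbT [0 < _]lt_neqAle beta_ge0 andbT.
  split; apply/eqP => E; move: x_gt0; rewrite /x.
    by rewrite E subrr mul0r ltxx.
  by rewrite -E mulr0 ltxx.
have Y_ge2 : 2 <= x / C by rewrite ler_pdivlMr.
have [p [p_pr p_le p_ge]] := prime_near _ Y_ge2.
have [m [T [m_ge T_few]]] := few_Fp p p_pr.
have [S [S_uniq S_sub m_le S_few]] :=
  exists_many_few_in_subspace _ _ _ _ _ _ _ _ T k_gt0 p_pr K_conv K_sym last_lt1 beta_gt0 p_le T_few.
exists S; split=> //; split=> //; split=> [|U _]; last by rewrite -ltnS leqW.
(* Since D <= d, the loss eps/(2d) in the exponent of the prime costs at most eps/2 after raising to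
   the power D - eps/2. *)
have Dd : (1 - eps / (2 * d%:R)) * (D - eps / 2) >= D - eps.
  have : eps / (2 * d%:R) * D <= eps / 2.
    rewrite invfM mulrA -mulrA ler_piMr //; first lra.
    by rewrite ler_pdivrMl ?mulr1 //; lra.
  have : 0 <= eps / (2 * d%:R) * (eps / 2) by rewrite mulr_ge0 //; lra.
  lra.
apply: (@le_trans _ _ (c2 * powR x (D - eps))).
  by rewrite ler_wpM2r ?powR_ge0 // ge_min lexx orbT.
have p_pow : powR c0 (D - eps / 2) * powR (x / C) (D - eps) <= powR p%:R (D - eps / 2).
  apply: (@le_trans _ _ (powR (c0 * powR (x / C) (1 - eps / (2 * d%:R))) (D - eps / 2))).
    rewrite powRM ?powR_ge0 ?(ltW c0_gt0) // -powRrM.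
    rewrite ler_wpM2l ?powR_ge0 // ler_powR //; lra.
  rewrite ge0_ler_powR ?nnegrE ?mulr_ge0 ?powR_ge0 ?ler0n ?(ltW c0_gt0) //; lra.
have m_leR : m%:R <= (size S)%:R * r%:R :> R by rewrite -natrM ler_nat.
have x_eq : powR x (D - eps) = powR (x / C) (D - eps) * powR C (D - eps).
  by rewrite -powRM ?divr_ge0 ?(ltW C_gt0) // divfK // gt_eqF.
have -> : c2 * powR x (D - eps) =
    powR c0 (D - eps / 2) * powR (x / C) (D - eps) / (2 * r%:R).
  by rewrite x_eq /c2; field; rewrite !gt_eqF ?powR_gt0.
by rewrite ler_pdivrMr ?mulr_gt0 //; lra.
Qed.
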